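(* The 1-type spectrum of a $\mathrm{GP}^2$ sentence is not always semilinear: there is a $\mathrm{GP}^2$ sentence $\varphi$ whose 1-type spectrum is not a semilinear set.
   Context: $\mathrm{GP}^2$ is the two-variable logic (variables $x,y$) over a vocabulary of unary and binary predicates, built from atomic formulas by Boolean connectives, unguarded unary quantification $\exists x\,\phi(x)$, and guarded Presburger quantifiers $\big(\sum_t\kappa_t\cdot\#_y[\phi_t(x,y)]\big)\circledast\delta$ where each $\phi_t$ has the form $R(x,y)\wedge\psi$ or $R(y,x)\wedge\psi$ for a binary predicate $R$, $\kappa_t,\delta\in\mathbb{Z}$, $\circledast$ an (in)equality, and $\#_y[\phi(x,y)]$ at $a$ denotes the number of $b$ with $\phi(a,b)$. With unary predicates $U_1,\dots,U_n$ and binary predicates $R_1,\dots,R_m$, a 1-type is a maximal consistent subset of $\{U_i(x),\neg U_i(x)\}_{i\le n}\cup\{R_i(x,x),\neg R_i(x,x)\}_{i\le m}$; the 1-type spectrum of a sentence is the set of vectors (indexed by 1-types in a fixed order) counting, for each finite model, how many elements realize each 1-type. A set of vectors of naturals is semilinear if it is a finite union of linear sets $\{b+\sum_j\lambda_jp_j:\lambda_j\in\mathbb{N}\}$ (equivalently Presburger definable). *)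

(* Defs.v *)
From mathcomp Require Import all_boot all_order all_algebra.

Set Implicit Arguments.
Unset Strict Implicit.
Unset Printing Implicit Defensive.

Import GRing.Theory Num.Theory.
Local Open Scope ring_scope.

(** * Syntax *)

(** The two variables; [~~ v] is the variable other than [v]. *)
Definition var : Type := bool.
Definition vx : var := true.
Definition vy : var := false.

Inductive cmp : Type := CEq | CNe | CLe | CGe | CLt | CGt.

(** Two-variable formulas over unary predicates [U_i], [i < n], and binary
    predicates [R_i], [i < m].  The atoms are those of the vocabulary; there is
    no equality atom.
    [FPres v kappa guard psi op delta] is the quantifier counting over [v],
      (sum_(t < k) kappa_t * #_v[phi_t]) op delta,
    with [w := ~~ v] as its free variable, where [phi_t] is
      [R_i(w,v) /\ psi_t]  if [guard t = (i, true)],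
      [R_i(v,w) /\ psi_t]  if [guard t = (i, false)]. *)
Inductive formula2 (n m : nat) : Type :=
| FUn of 'I_n & var
| FBin of 'I_m & var & var
| FNot of formula2 n m
| FAnd of formula2 n m & formula2 n m
| FOr of formula2 n m & formula2 n m
| FEx of var & formula2 n m
| FPres (v : var) (k : nat) (kappa : 'I_k -> int) (guard : 'I_k -> 'I_m * bool)
    (psi : 'I_k -> formula2 n m) (op : cmp) (delta : int).

(** In [FPres] the guards already mention both variables. *)
Fixpoint is_free n m (u : var) (phi : formula2 n m) : bool :=
  match phi with
  | FUn _ v => u == v
  | FBin _ v w => (u == v) || (u == w)
  | FNot f => is_free u f
  | FAnd f g | FOr f g => is_free u f || is_free u g
  | FEx v f => (u != v) && is_free u f
  | @FPres _ _ v k _ _ _ _ _ => (0 < k)%N && (u != v)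
  end.

(** The only constraint not built into [formula2]: unguarded quantification
    applies to formulas with at most the quantified variable free. *)
Fixpoint is_gp2 n m (phi : formula2 n m) : bool :=
  match phi with
  | FUn _ _ | FBin _ _ _ => true
  | FNot f => is_gp2 f
  | FAnd f g | FOr f g => is_gp2 f && is_gp2 g
  | FEx v f => is_gp2 f && ~~ is_free (~~ v) f
  | @FPres _ _ _ k _ _ psi _ _ => [forall t : 'I_k, is_gp2 (psi t)]
  end.

Definition gp2_sentence n m (phi : formula2 n m) : bool :=
  [&& is_gp2 phi, ~~ is_free vx phi & ~~ is_free vy phi].

(** * Semantics over finite structures *)

Record structure (n m : nat) : Type := Structure {
  dom :> finType;
  un : 'I_n -> pred dom;
  bin : 'I_m -> rel dom;
  dom_gt0 : (0 < #|dom|)%N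
}.

Definition upd (T : Type) (e : var -> T) (v : var) (a : T) : var -> T :=
  fun w => if w == v then a else e w.

Definition cmp_holds (op : cmp) (a b : int) : bool :=
  match op with
  | CEq => a == b
  | CNe => a != b
  | CLe => a <= b
  | CGe => a >= b
  | CLt => a < b
  | CGt => a > b
  end.

Definition guard_holds n m (M : structure n m) (e : var -> M) (v : var)
    (g : 'I_m * bool) : bool :=
  if g.2 then bin g.1 (e (~~ v)) (e v) else bin g.1 (e v) (e (~~ v)).

Fixpoint sat n m (M : structure n m) (e : var -> M) (phi : formula2 n m) :
    bool :=
  match phi with
  | FUn i v => un i (e v)
  | FBin i v w => bin i (e v) (e w)
  | FNot f => ~~ sat e f
  | FAnd f g => sat e f && sat e g
  | FOr f g => sat e f || sat e g
  | FEx v f => [exists a : M, sat (upd e v a) f]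
  | @FPres _ _ v k kappa guard psi op delta =>
      cmp_holds op
        (\sum_(t < k) kappa t *
           (#|[set a : M | guard_holds (upd e v a) v (guard t)
                           && sat (upd e v a) (psi t)]|)%:Z)
        delta
  end.

(** For a sentence the valuation is irrelevant. *)
Definition models n m (M : structure n m) (phi : formula2 n m) : Prop :=
  forall e : var -> M, sat e phi.

(** * 1-types and spectra *)

(** [(inl i, b)] is the literal [U_i(x)] or its negation, [(inr i, b)] is
    [R_i(x,x)] or its negation, negated when [b = false]. *)
Definition literal (n m : nat) : finType := (('I_n + 'I_m) * bool)%type.

Definition consistent n m (S : {set literal n m}) : bool :=
  [forall a : 'I_n + 'I_m, ~~ (((a, true) \in S) && ((a, false) \in S))].

Definition one_type (n m : nat) : finType :=
  {S : {set literal n m} | maxset (@consistent n m) S}.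

Definition literal_holds n m (M : structure n m) (a : M) (l : literal n m) :
    bool :=
  match l.1 with
  | inl i => un i a == l.2
  | inr i => bin i a a == l.2
  end.

Definition realizes n m (M : structure n m) (a : M) (tau : one_type n m) :
    bool :=
  [forall l in val tau, literal_holds a l].

Definition type_vector n m (M : structure n m) : {ffun one_type n m -> nat} :=
  [ffun tau => #|[set a : M | realizes a tau]|].

Definition spectrum n m (phi : formula2 n m) (c : {ffun one_type n m -> nat}) :
    Prop :=
  exists M : structure n m, models M phi /\ c = type_vector M.

(** * Semilinear sets of vectors of naturals *)

Definition linear_set (I : finType) (S : {ffun I -> nat} -> Prop) : Prop :=
  exists (b : {ffun I -> nat}) (k : nat) (p : 'I_k -> {ffun I -> nat}),
    forall c, S c <->
      exists lambda : 'I_k -> nat, c = b + \sum_(j < k) p j *+ lambda j.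

Definition semilinear_set (I : finType) (S : {ffun I -> nat} -> Prop) : Prop :=
  exists (N : nat) (L : 'I_N -> {ffun I -> nat} -> Prop),
    (forall i, linear_set (L i)) /\ (forall c, S c <-> exists i, L i c).

(* Main.v *)
(** Let [U] split the domain into [B] (where [U] holds) and [A].  The sentence
    says that every element of [B] has an [R]-predecessor in [A], and that every
    element of [A] has at most as many [R]-successors in [B] as in [A].  Hence
    [|B| <= |A|^2], and equality is possible for every [|A| > 0].  But in a
    semilinear set on which [|B|] is bounded by any function of [|A|], a period
    that does not increase [|A|] cannot increase [|B|] either, so [|B|] would be
    bounded linearly in [|A|]. *)
Require Import Defs.
From mathcomp Require Import all_boot all_order all_algebra.
From mathcomp Require Import zify.

Set Implicit Arguments.
Unset Strict Implicit.
Unset Printing Implicit Defensive.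

Import GRing.Theory Num.Theory.

Section WeightedSums.
Variable I : finType.

(** With [P] selecting the 1-types that contain a given literal on [U], this recovers |A| or |B|
    from a type vector. *)
Definition wsum (P : pred I) (c : {ffun I -> nat}) : nat :=
  (\sum_(i | P i) c i)%N.

Lemma wsumD (P : pred I) (c d : {ffun I -> nat}) :
  wsum P (c + d)%R = (wsum P c + wsum P d)%N.
Proof. by rewrite /wsum -big_split; apply: eq_bigr => i _; rewrite ffunE. Qed.

Lemma wsum0 (P : pred I) : wsum P 0%R = 0%N.
Proof. by rewrite /wsum big1 // => i _; rewrite ffunE. Qed.

Lemma wsumMn (P : pred I) (c : {ffun I -> nat}) k :
  wsum P (c *+ k)%R = (k * wsum P c)%N.
Proof. by elim: k => [|k IH]; rewrite ?mulr0n ?wsum0 // mulrS wsumD IH mulSn. Qed.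

Lemma wsum_comb (P : pred I) (b : {ffun I -> nat}) k
    (p : 'I_k -> {ffun I -> nat}) (lambda : 'I_k -> nat) :
  wsum P (b + \sum_(j < k) p j *+ lambda j)%R =
  (wsum P b + \sum_(j < k) lambda j * wsum P (p j))%N.
Proof.
rewrite wsumD (big_morph (wsum P) (wsumD P) (wsum0 P)).
by congr (_ + _)%N; apply: eq_bigr => j _; rewrite wsumMn.
Qed.

Lemma linear_set_growth (S : {ffun I -> nat} -> Prop) (P Q : pred I)
    (f : nat -> nat) :
  linear_set S -> (forall c, S c -> (wsum Q c <= f (wsum P c))%N) ->
  exists C : nat, forall c, S c -> (wsum Q c <= C * (wsum P c).+1)%N.
Proof.
move=> [b [k [p Sp]]] Sf.
have period0 j : wsum P (p j) = 0%N -> wsum Q (p j) = 0%N.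
  (* Repeating period [j] this often keeps the [P]-weight of [b], but a positive [Q]-weight of [p j]
     would exceed the bound [f]. *)
  move=> Pj0; pose l := (f (wsum P b)).+1.
  have /Sf : S (b + \sum_(i < k) p i *+ (if i == j then l else 0%N))%R.
    by apply/Sp; exists (fun i => if i == j then l else 0%N).
  rewrite !wsum_comb !(bigD1 (P := predT) j) //= eqxx Pj0 muln0.
  rewrite !big1 ?addn0; last 2 first.
  - by move=> i /negPf ->.
  - by move=> i /negPf ->.
  by rewrite /l; case: (wsum Q (p j)) => // q; nia.
(* [D] dominates the [Q]-weight of every single period, and a period not covered by [period0] has
   [P]-weight at least 1. *)
pose D := (\sum_(j < k) wsum Q (p j))%N.
have periodD j : (wsum Q (p j) <= D * wsum P (p j))%N.
  have [/period0 -> //|Pj_gt0] := posnP (wsum P (p j)).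
  by apply: leq_trans (leq_pmulr _ Pj_gt0); rewrite /D (bigD1 j) //= leq_addr.
(* The [.+1] in the bound absorbs [wsum Q b], even when the [P]-weight of [c] is 0. *)
exists (D + wsum Q b)%N => c /Sp[lambda ->]; rewrite !wsum_comb.
have: (\sum_(j < k) lambda j * wsum Q (p j) <=
        D * \sum_(j < k) lambda j * wsum P (p j))%N.
  rewrite big_distrr; apply: leq_sum => j _ /=.
  by rewrite mulnCA leq_mul2l periodD orbT.
by nia.
Qed.

Lemma semilinear_set_growth (S : {ffun I -> nat} -> Prop) (P Q : pred I)
    (f : nat -> nat) :
  semilinear_set S -> (forall c, S c -> (wsum Q c <= f (wsum P c))%N) ->
  exists C : nat, forall c, S c -> (wsum Q c <= C * (wsum P c).+1)%N.
Proof.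
move=> [N [L [linL SL]]] Sf.
have /fin_all_exists[C LC] i : exists C : nat,
    forall c, L i c -> (wsum Q c <= C * (wsum P c).+1)%N.
  by apply: linear_set_growth (linL i) _ => c Lc; apply/Sf/SL; exists i.
exists (\sum_i C i)%N => c /SL[i /LC /leq_trans]; apply.
by rewrite leq_mul2r /= (bigD1 i) //= leq_addr.
Qed.

End WeightedSums.

Section OneTypes.
Variables (n m : nat) (M : structure n m).

Lemma literal_set_max (a : M) :
  maxset (@consistent n m) [set l | literal_holds a l].
Proof.
apply/maxsetP; split.
  by apply/forallP=> -[] i; rewrite !inE /literal_holds /=; case: (_ a).
move=> S /forallP consS sub; apply/eqP; rewrite eqEsubset sub andbT.
apply/subsetP=> -[i b] Sib; rewrite inE; apply: contraT => nib.
(* A literal false at [a] has its negation true at [a], so adding it to the set breaks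
   consistency. *)
have: (i, ~~ b) \in S.
  apply: (subsetP sub); rewrite inE.
  by move: nib; rewrite /literal_holds; case: i {Sib} => i /=; case: (_ a); case: b.
by move: (consS i) Sib; case: b {nib} => /= /negP nS S1 S2; case: nS; rewrite S1 S2.
Qed.

Definition type_of (a : M) : one_type n m := 
  exist (fun S => maxset (@consistent n m) S) _ (literal_set_max a).

(** Both sides are maximal consistent sets, so inclusion of [tau] in the literals true at [a] forces
    equality. Hence 1-types partition the domain. *)
Lemma realizesE (a : M) (tau : one_type n m) :
  realizes a tau = (tau == type_of a).
Proof.
apply/idP/eqP=> [/forall_inP real|->]; last first.
  by apply/forall_inP=> l; rewrite inE.
apply/val_inj=> /=; case/maxsetP: (valP tau) => _ maxtau.
apply/esym/maxtau; last by apply/subsetP=> l /real; rewrite inE.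
by case/maxsetP: (literal_set_max a).
Qed.

Lemma wsum_type_vector (l : literal n m) :
  wsum (fun tau : one_type n m => l \in val tau) (type_vector M) =
  #|[set a : M | literal_holds a l]|.
Proof.
rewrite /wsum -sum1dep_card (partition_big type_of (fun tau => l \in val tau)) /=.
  apply: eq_bigr => tau ltau; rewrite ffunE -sum1dep_card.
  apply: eq_bigl => a; rewrite realizesE eq_sym; case: eqP => [Da|]; last by rewrite andbF.
  by move: ltau; rewrite -Da inE => ->.
by move=> a; rewrite inE.
Qed.

End OneTypes.

Definition U_at (v : var) : formula2 1 1 := FUn 1 ord0 v.

(** The flag [false] orients the guard as R(y,x), so predecessors of x are counted. *)
Definition has_A_pred : formula2 1 1 :=
  FPres vy (fun _ : 'I_1 => 1%R) (fun _ => (ord0, false))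
    (fun _ => FNot (U_at vy)) CGe 1%R.

(** The coefficients 1 and -1 turn the comparison of two counts into a single Presburger
    constraint. *)
Definition B_succ_le_A_succ : formula2 1 1 :=
  FPres vy (fun t : 'I_2 => if t == ord0 then 1%R else (-1)%R)
    (fun _ => (ord0, true))
    (fun t => if t == ord0 then U_at vy else FNot (U_at vy)) CLe 0%R.

Definition square_sentence : formula2 1 1 :=
  FNot (FEx vx (FNot
    (FOr (FAnd (U_at vx) has_A_pred)
         (FAnd (FNot (U_at vx)) B_succ_le_A_succ)))).

Lemma square_sentence_gp2 : gp2_sentence square_sentence.
Proof.
rewrite /gp2_sentence /= !andbT.
by apply/andP; split; apply/forallP=> t //; case: ifP.
Qed.

Section SquareSentence.
Variable M : structure 1 1.
Let U : pred M := un ord0.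
Let R : rel M := bin ord0.

Lemma models_squareP :
  models M square_sentence <->
  forall a : M,
    if U a then [exists b, R b a && ~~ U b]
    else (#|[set b | R a b && U b]| <= #|[set b | R a b && ~~ U b]|)%N.
Proof.
have satE (e : var -> M) : sat e square_sentence =
    [forall a : M,
      if U a then [exists b, R b a && ~~ U b]
      else (#|[set b | R a b && U b]| <= #|[set b | R a b && ~~ U b]|)%N].
  rewrite /= negb_exists; apply: eq_forallb => a.
  rewrite negbK big_ord1 !big_ord_recl big_ord0 /= /upd /=.
  rewrite /guard_holds /= -/U -/R.
  case: (U a); rewrite ?orbF /=.
    rewrite mul1r lez_nat card_gt0; apply/set0Pn/existsP=> -[b Rb];
      by exists b; move: Rb; rewrite ?inE.
  by rewrite mul1r mulN1r addr0 subr_le0 lez_nat.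
split=> [modM a|allM e]; last by rewrite satE; apply/forallP.
(* Nonemptiness of the domain supplies a valuation at which to use [modM]. *)
by move: a; apply/forallP; case/card_gt0P: (dom_gt0 M) => a0 _; rewrite -(satE (fun _ => a0)).
Qed.

(** Double counting of the [R]-edges from A to B: each element of B receives at least one, and each
    element of A sends at most |A|. *)
Lemma square_bound : models M square_sentence ->
  (#|[set a | U a]| <= #|[set a | ~~ U a]| ^ 2)%N.
Proof.
move/models_squareP=> modM; rewrite -sum1dep_card.
apply: (@leq_trans (\sum_(b | U b) \sum_(a | ~~ U a) R a b)%N).
  apply: leq_sum => b Ub; have := modM b; rewrite Ub => /existsP[a /andP[Rab Ua]].
  by rewrite (bigD1 a) //= Rab.
rewrite exchange_big /= -mulnn -{1}sum1dep_card big_distrl /=.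
apply: leq_sum => a Ua; rewrite mul1n.
have -> : (\sum_(b | U b) R a b = #|[set b | R a b && U b]|)%N.
  rewrite -sum1dep_card big_mkcond [RHS]big_mkcond /=.
  by apply: eq_bigr => b _; case: (R a b); case: (U b).
have := modM a; rewrite (negPf Ua) => /leq_trans; apply.
by apply/subset_leq_card/subsetP=> b; rewrite !inE => /andP[].
Qed.

End SquareSentence.

Section SquareModel.
Variable k : nat.

(** [(None, i)] is the [i]-th element of [A]; its [R]-successors are [A] and the
    [k.+1] elements [(Some j, i)] of [B]. *)
Definition square_dom : finType := (option 'I_k.+1 * 'I_k.+1)%type.

Lemma square_dom_gt0 : (0 < #|square_dom|)%N.
Proof. by apply/card_gt0P; exists (None, ord0). Qed.

Definition square_model : structure 1 1 :=
  @Structure 1 1 square_dom (fun _ p => isSome p.1)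
    (fun _ p q => ~~ isSome p.1 && (isSome q.1 ==> (p.2 == q.2)))
    square_dom_gt0.

Lemma card_square_A : #|[set p : square_dom | ~~ isSome p.1]| = k.+1.
Proof.
rewrite -[RHS]card_ord -cardsT -[RHS](@card_imset _ _ (pair (None : option 'I_k.+1))).
  apply: eq_card => -[[j|] i]; rewrite !inE /=; apply/esym/imsetP; first by case.
  by exists i.
by move=> i j [].
Qed.

Lemma card_square_B : #|[set p : square_dom | isSome p.1]| = (k.+1 ^ 2)%N.
Proof.
(* B is the complement of A in a domain of (k+2)(k+1) elements. *)
have := cardsC [set p : square_dom | isSome p.1].
have -> : ~: [set p : square_dom | isSome p.1] = [set p | ~~ isSome p.1].
  by apply/setP=> p; rewrite !inE.
by rewrite card_square_A card_prod card_option card_ord; lia.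
Qed.

Lemma square_model_sat : models square_model square_sentence.
Proof.
apply/models_squareP=> -[[j|] i] /=.
  by apply/existsP; exists (None, i); rewrite /= eqxx.
have -> : #|[set q : square_dom | (isSome q.1 ==> (i == q.2)) && ~~ isSome q.1]|
    = k.+1.
  by apply: etrans card_square_A; apply: eq_card => -[[j|] i']; rewrite !inE /= ?andbF.
rewrite -[leqRHS]card_ord -cardsT.
(* The successors of [(None, i)] in B lie in the column of index [i], which has as many elements as
   A. *)
rewrite -[leqRHS](@card_imset _ _ (fun j : 'I_k.+1 => (Some j, i))); last by move=> j j' [].
apply/subset_leq_card/subsetP=> -[[j|] i']; rewrite !inE //= andbT => /eqP <-.
by apply/imsetP; exists j.
Qed.

End SquareModel.

Theorem theorem39 :
  exists (n m : nat) (phi : formula2 n m),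
    gp2_sentence phi /\ ~ semilinear_set (spectrum phi).
Proof.
exists 1, 1, square_sentence; split; first exact: square_sentence_gp2.
pose lit b : literal 1 1 := (inl ord0, b).
pose P b := fun tau : one_type 1 1 => lit b \in val tau.
have countA (M : structure 1 1) :
    wsum (P false) (type_vector M) = #|[set a : M | ~~ un ord0 a]|.
  rewrite wsum_type_vector; apply: eq_card => a.
  by rewrite !inE /literal_holds /= eqbF_neg.
have countB (M : structure 1 1) :
    wsum (P true) (type_vector M) = #|[set a : M | un ord0 a]|.
  rewrite wsum_type_vector; apply: eq_card => a.
  by rewrite !inE /literal_holds /= eqb_id.
move=> /(semilinear_set_growth (P := P false) (Q := P true) (f := fun x => x ^ 2)%N).
case=> [c [M [modM ->]]|C growth].
  by rewrite countA countB; apply: square_bound.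
(* Here |A| = 2C+1, and |B| = (2C+1)^2 exceeds the claimed bound C(2C+2), also for C = 0. *)
have /growth : spectrum square_sentence (type_vector (square_model (2 * C))).
  by exists (square_model (2 * C)); split; first exact: square_model_sat.
rewrite countA countB card_square_A card_square_B; nia.
Qed.
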